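(* Let $N\ge1$ and let $(s_\sigma)_{\sigma\in\mathbb{F}_N^+}$ be a family of complex numbers. The numbers $s_\sigma$, $\sigma\in\mathbb{F}_N^+$, are the moments of a GNS functional on $\mathcal{P}_N^0$ if and only if there exists a positive definite kernel $L$ on $\mathbb{F}_N^+$ (with complex values) such that $-L\le K\le L$, where $K(\sigma,\tau)=s_{\mathfrak{I}(\sigma)\tau}$, $\sigma,\tau\in\mathbb{F}_N^+$.
   Context: $\mathbb{F}_N^+$ is the unital free semigroup on $N$ generators $g_1,\dots,g_N$ (its identity is the empty word), with involution $\mathfrak{I}$ reversing words: $\mathfrak{I}(g_{j_1}\cdots g_{j_k})=g_{j_k}\cdots g_{j_1}$. $\mathcal{P}_N^0$ is the unital algebra of complex polynomials in $N$ non-commuting indeterminates $Y_1,\dots,Y_N$. For $\sigma=g_{j_1}\cdots g_{j_l}$ write $Y_\sigma=Y_{j_1}\cdots Y_{j_l}$, so that each $P\in\mathcal{P}_N^0$ is uniquely a finite sum $P=\sum_\sigma c_\sigma Y_\sigma$. It is a $*$-algebra with the involution $P^*=\sum_\sigma\overline{c_\sigma}\,Y_{\mathfrak{I}(\sigma)}$. A linear functional $Z$ on $\mathcal{P}_N^0$ is hermitian if $Z(P^* )=\overline{Z(P)}$ for all $P$. Its moments are the numbers $s_\sigma=Z(Y_\sigma)$, $\sigma\in\mathbb{F}_N^+$. A Kreĭn space is an indefinite inner product space $(\mathcal{K},[\cdot,\cdot]_{\mathcal{K}})$ for which there is a positive inner product $\langle\cdot,\cdot\rangle$ making $\mathcal{K}$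 a Hilbert space and an operator $J$ with $J^*=J^{-1}=J$ such that $[\xi,\eta]=\langle J\xi,\eta\rangle$; topological notions refer to this Hilbert space topology. $T^\sharp$ denotes the adjoint of a densely defined operator $T$ with respect to $[\cdot,\cdot]_{\mathcal{K}}$. A hermitian closable representation $\pi$ of $\mathcal{P}_N^0$ on a Kreĭn space $\mathcal{K}$ is a linear map assigning to each $P\in\mathcal{P}_N^0$ a closable linear operator $\pi(P)$ defined on a common dense linear subspace $\mathcal{D}(\pi)\subset\mathcal{K}$ (the domain of $\pi$), which is invariant under all $\pi(P)$, such that $\pi(1)$ is the identity on $\mathcal{D}(\pi)$, $\pi(PQ)=\pi(P)\pi(Q)$, and for each $P$ the domain of $\pi(P)^\sharp$ contains $\mathcal{D}(\pi)$ and $\pi(P)^\sharp|_{\mathcal{D}(\pi)}=\pi(P^* )$. A hermitian functional $Z$ is a GNS functional if it admits GNS data: a triplet $(\pi,\mathcal{K},\Omega)$ where $\pi$ is a hermitian closable representation of $\mathcal{P}_N^0$ on a Kreĭn space $\mathcal{K}$ and $\Omega\in\mathcal{D}(\pi)$ satisfies $Z(P)=[\pi(P)\Omega,\Omega]_{\mathcal{K}}$ for all $P$, and the linear span (without closure) of $\{\pi(P)\Omega\mid P\in\mathcal{P}_N^0\}$ equals $\mathcal{D}(\pi)$. A (complex valued) kernel on a set $X$ is a map $K:X\times X\to\mathbb{C}$; it is hermitian if $K(x,y)=\overline{K(y,x)}$. For finitely supported $f,g:X\to\mathbb{C}$ put $[f,g]_K=\sum_{x,y}K(x,y)f(y)\overline{g(x)}$.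 A hermitian kernel $L$ is positive definite if $[f,f]_L\ge0$ for all $f$; for hermitian kernels, $A\le B$ means $[f,f]_A\le[f,f]_B$ for all finitely supported $f$ (so $-L\le K\le L$ includes that $K$ is hermitian). *)

(* Defs.v *)
From HB Require Import structures.
From mathcomp Require Import all_boot all_order all_algebra.
From mathcomp Require Import finmap monalg complex.
From mathcomp Require Import boolp classical_sets reals topology normedtype.

Set Implicit Arguments.
Unset Strict Implicit.
Unset Printing Implicit Defensive.

Import Order.TTheory GRing.Theory Num.Theory Num.Def.

Local Open Scope classical_set_scope.
Local Open Scope ring_scope.

(* The free semigroup on N generators is the free monoid {fmonom 'I_N};
   polynomials in N noncommuting indeterminates form its monoid algebra, in
   which << w >> is the monomial Y_w and P@_w is the coefficient of Y_w. *)
Notation ncpoly R N := {malg R[i][{fmonom 'I_N}]}.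

Definition word_rev (N : nat) (w : {fmonom 'I_N}) : {fmonom 'I_N} :=
  FMonom (rev w).

Definition ncvar (R : realType) (N : nat) (i : 'I_N) : ncpoly R N :=
  << fmu i >>.

Lemma monomialE (R : realType) (N : nat) (w : {fmonom 'I_N}) :
  << w >> = \prod_(i <- (w : seq 'I_N)) ncvar R i :> ncpoly R N.
Proof.
case: w => w /=; elim: w => [|i w IHw]; first by rewrite big_nil -fmoneE.
rewrite big_cons -IHw /ncvar.
transitivity (fgmul (<< fmu i >> : ncpoly R N) << FMonom w >>); last by [].
by rewrite fgmulUU mulr1 /mmul /= fmmulE fmuE.
Qed.

Definition ncpoly_star (R : realType) (N : nat) (P : ncpoly R N) : ncpoly R N :=
  \sum_(w <- msupp P) << conjC P@_w *g word_rev w >>.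

Definition hermitian_functional (R : realType) (N : nat)
    (Z : {scalar ncpoly R N}) : Prop :=
  forall P, Z (ncpoly_star P) = conjC (Z P).

Definition is_subspace (C : pzRingType) (V : lmodType C) (D : set V) : Prop :=
  D 0 /\ forall (a : C) x y, D x -> D y -> D (a *: x + y).

Definition linear_span (C : pzRingType) (V : lmodType C) (S : set V) : set V :=
  smallest (@is_subspace C V) S.

(* The norm (hence the topology, and completeness) carried by H is required to
   be the one given by the positive inner product; different choices of that
   inner product and of J for the same form induce the same topology. *)
Definition krein_axiom (R : realType) (H : completeNormedModType R[i])
    (br : H -> H -> R[i]) : Prop :=
  exists (ip : {dot H for conjC}) (J : {linear H -> H}),
    [/\ forall x, `|x| ^+ 2 = ip x x,
        forall x y, ip (J x) y = ip x (J y),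
        cancel J J
      & forall x y, br x y = ip (J x) y].

Record kreinSpace (R : realType) := KreinSpace {
  krein_sort :> completeNormedModType R[i];
  krein_form : krein_sort -> krein_sort -> R[i];
  krein_formP : krein_axiom krein_form
}.

(* An operator with domain D is a function T : K -> K of which only the values
   on D are meaningful. *)
Section Operators.
Variables (R : realType) (K : kreinSpace R).
Implicit Types (D : set K) (T : K -> K).

Definition linear_on D T : Prop :=
  forall (a : R[i]) x y, D x -> D y -> T (a *: x + y) = a *: T x + T y.

Definition op_graph D T : set (K * K) := [set p | D p.1 /\ p.2 = T p.1].

(* The closure of the graph is again the graph of an operator. *)
Definition closable D T : Prop :=
  forall x y y', closure (op_graph D T) (x, y) ->
    closure (op_graph D T) (x, y') -> y = y'.

(* The graph of the adjoint with respect to the indefinite form; it is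
   single-valued when D is dense. *)
Definition adj_graph D T : set (K * K) :=
  [set p | forall x, D x -> krein_form (T x) p.1 = krein_form x p.2].

End Operators.

Record hermitian_closable_rep (R : realType) (N : nat) (K : kreinSpace R)
    (D : set K) (pi : ncpoly R N -> K -> K) : Prop := HermitianClosableRep {
  rep_dom_subspace : is_subspace D;
  rep_dom_dense : dense D;
  rep_dom_inv : forall P x, D x -> D (pi P x);
  rep_op_linear : forall P, linear_on D (pi P);
  rep_op_closable : forall P, closable D (pi P);
  rep_linear : forall (a : R[i]) P Q x, D x ->
    pi (a *: P + Q) x = a *: pi P x + pi Q x;
  rep_one : forall x, D x -> pi 1 x = x;
  rep_mul : forall P Q x, D x -> pi (P * Q) x = pi P (pi Q x);
  (* D is contained in the domain of the adjoint of pi P, and the adjoint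
     restricts to pi P^* on D *)
  rep_adj : forall P y, D y -> adj_graph D (pi P) (y, pi (ncpoly_star P) y)
}.

Definition gns_data (R : realType) (N : nat) (Z : {scalar ncpoly R N})
    (K : kreinSpace R) (D : set K) (pi : ncpoly R N -> K -> K) (Omega : K) :
    Prop :=
  [/\ hermitian_closable_rep D pi,
      D Omega,
      forall P, Z P = krein_form (pi P Omega) Omega
    & linear_span (range (fun P => pi P Omega)) = D].

Definition gns_functional (R : realType) (N : nat) (Z : {scalar ncpoly R N}) :
    Prop :=
  hermitian_functional Z /\
  exists (K : kreinSpace R) (D : set K) (pi : ncpoly R N -> K -> K) (Omega : K),
    gns_data Z D pi Omega.

Section Kernels.
Variables (R : realType) (X : choiceType).
Implicit Types (A B L : X -> X -> R[i]) (f g : {fsfun X -> R[i] with 0}).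

Definition hermitian_kernel A : Prop := forall x y, A x y = conjC (A y x).

Definition kernel_form A f g : R[i] :=
  \sum_(x <- finsupp g) \sum_(y <- finsupp f) A x y * f y * conjC (g x).

(* For z, w : R[i], z <= w means that w - z is a nonnegative real. *)
Definition positive_definite L : Prop :=
  hermitian_kernel L /\ forall f, 0 <= kernel_form L f f.

Definition kernel_le A B : Prop :=
  [/\ hermitian_kernel A, hermitian_kernel B
    & forall f, kernel_form A f f <= kernel_form B f f].

End Kernels.

Definition hankel_kernel (R : realType) (N : nat) (s : {fmonom 'I_N} -> R[i]) :
    {fmonom 'I_N} -> {fmonom 'I_N} -> R[i] :=
  fun v w => s (mmul (word_rev v) w).

(* Main.v *)
Require Import Defs.
From HB Require Import structures.
From mathcomp Require Import all_boot all_order all_algebra.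
From mathcomp Require Import ring lra.
From mathcomp Require Import finmap monalg complex.
From mathcomp Require Import boolp classical_sets reals topology normedtype.
From mathcomp Require Import sequences.

(** If the moments come from GNS data on a Krein space with inner product
    [<x, y>] and symmetry [J], so that its form is [<J x, y>], then with
    [u w = pi(Y_w) Omega] the Hankel kernel is [K(v, w) = <J u_w, u_v>].  The
    Gram kernel [L(v, w) = <u_w, u_v>] dominates [K] and [- K], because
    [2 (<x, x> +- <J x, x>) = <x +- J x, x +- J x>] is nonnegative
    ([moments_majorant]).

    For the converse, let [V] be the space of polynomials, with the hermitian
    form [k(P, Q) = Z(Q^* P)] and the quadratic form [q] of [L], so that
    [|k(f, f)| <= q f].  Completing [V] for [q] gives a Hilbert space on which
    [k] is represented by a selfadjoint contraction [G], but a Krein space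
    needs a symmetry.  So [q] is first replaced by another majorant of [k] for
    which [G] is a symmetry.  Formally it is the quadratic form of the absolute
    value of [G].  It is reached without spectral theory by Newton's iteration
    [q |-> (q + q^k) / 2], where [q^k f], the supremum over [g] of
    [2 Re k(f, g) - q g], is the squared norm of [k(f, .)] in the dual of
    [(V, q)].  Each step yields a smaller majorant, and the decreasing limit is
    a majorant with [q^k = q] ([exists_selfdual_majorant]).

    The completion is built as a space of functionals on [V], those that are
    bounded for [q].  The variational formula for the squared dual norm, the
    supremum over [g] of [2 Re p(g) - q g], makes this painless: the
    parallelogram law, the density of [V] and the Riesz representation all
    come from substitutions inside the supremum ([dualq_para],
    [dquadB_embed], [repolar_embed]).  On this Hilbert space [q^k = q] says
    that [G] is isometric on a dense subspace, and a selfadjoint isometry is a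
    symmetry ([symmetryK], [symmetry_adj]).  This produces a Krein space with a
    dense copy of [V] on which the indefinite form is [k]
    ([krein_space_of_majorant]).

    The representation is left multiplication on that copy of [V].  The
    identity [k(P F, G) = k(F, P^* G)] and density show that it is well defined
    and compatible with the involution.  It also gives closability, since each
    operator has a densely defined adjoint ([krein_adjoint_closable]). *)

Set Implicit Arguments.
Unset Strict Implicit.
Unset Printing Implicit Defensive.

Import Order.TTheory GRing.Theory Num.Theory Num.Def.
Import numFieldNormedType.Exports.

Local Open Scope classical_set_scope.
Local Open Scope ring_scope.
Local Notation "x %:C" := (real_complex _ x) (format "x %:C") : ring_scope.

Local Notation Re := complex.Re.
Local Notation Im := complex.Im.

(** * Complex moduli and additive functions *)

Definition sqnorm (R : realType) (c : R[i]) : R := Re c ^+ 2 + Im c ^+ 2.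

Section Sqnorm.
Variable R : realType.
Implicit Types (c d : R[i]) (t : R).

Lemma sqnorm_ge0 c : 0 <= sqnorm c.
Proof. by rewrite addr_ge0 ?sqr_ge0. Qed.

Lemma sqnorm_eq0 c : sqnorm c = 0 -> c = 0.
Proof.
case: c => a b; rewrite /sqnorm /= => /eqP.
by rewrite paddr_eq0 ?sqr_ge0// !sqrf_eq0 => /andP[/eqP-> /eqP->].
Qed.

Lemma sqnormM c d : sqnorm (c * d) = sqnorm c * sqnorm d.
Proof. by case: c d => a b [e f]; rewrite /sqnorm /=; ring. Qed.

Lemma sqnorm_real t : sqnorm t%:C = t ^+ 2.
Proof. by rewrite /sqnorm /= expr0n addr0. Qed.

Lemma sqnorm1 : sqnorm (1 : R[i]) = 1.
Proof. by rewrite -[1]/(1%:C) sqnorm_real expr1n. Qed.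

Lemma sqnormN1 : sqnorm (-1 : R[i]) = 1.
Proof. by rewrite -sqnorm1 /sqnorm /= !sqrrN. Qed.

Lemma conj_real_complex t : (t%:C : R[i])^* = t%:C.
Proof. exact: conjc_real. Qed.

Lemma mulJc c : c^* * c = (sqnorm c)%:C.
Proof.
case: c => a b; apply/eqP; rewrite eq_complex /sqnorm /=.
by apply/andP; split; apply/eqP; ring.
Qed.

Lemma mulcJ c : c * c^* = (sqnorm c)%:C.
Proof. by rewrite mulrC mulJc. Qed.

Lemma normc_sqr c : `|c| ^+ 2 = (sqnorm c)%:C.
Proof. by rewrite -add_Re2_Im2. Qed.

(** Periodicity does it: subtracting [t * g 1] leaves an additive function with
    period 1, hence bounded above, and an additive function that is bounded
    above vanishes. *)
Lemma additive_quadratic_bound_linear (g : R -> R) (C : R) :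
  (forall s t, g (s + t) = g s + g t) ->
  (forall t, g t <= C * (1 + t ^+ 2)) -> forall t, g t = t * g 1.
Proof.
move=> gD gC.
have gMn n t : g (n%:R * t) = n%:R * g t.
  elim: n => [|n IHn]; last by rewrite -natr1 !mulrDl !mul1r gD IHn.
  by have := gD 0 0; rewrite !mul0r addr0; lra.
have g0 : g 0 = 0 by have := gMn 0%N 0; rewrite !mul0r.
have gN t : g (- t) = - g t by have := gD t (- t); rewrite subrr g0; lra.
pose h t := g t - t * g 1.
have hD s t : h (s + t) = h s + h t by rewrite /h gD; ring.
have hn n : h n%:R = 0 by rewrite /h -[in g _](mulr1 n%:R) gMn subrr.
have hz (z : int) : h z%:~R = 0.
  case: z => n; first exact: hn.
  by rewrite NegzE rmorphN/= /h gN; have := hn n.+1; rewrite /h; lra.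
(* reduce to [0 <= u < 1] by subtracting the integer part *)
have hbound t : h t <= `|C| * 2 + `|g 1|.
  have -> : h t = h (t - (Num.floor t)%:~R).
    by have := hD (t - (Num.floor t)%:~R) (Num.floor t)%:~R; rewrite hz subrK addr0.
  set u := t - _.
  have u0 : 0 <= u by rewrite /u subr_ge0 Num.Theory.floor_le.
  have u1 : u <= 1 by rewrite /u lerBlDl; have := Num.Theory.floorD1_gt t; rewrite intrD; lra.
  rewrite /h; have Hg := gC u.
  have HC : C * (1 + u ^+ 2) <= `|C| * 2.
    apply: le_trans (ler_norm _) _; rewrite normrM ler_wpM2l//.
    by rewrite ger0_norm ?addr_ge0 ?sqr_ge0// -[2]/(1 + 1) lerD2l expr_le1.
  have H1 : - (u * g 1) <= `|g 1|.
    rewrite -mulrN; apply: le_trans (ler_norm _) _.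
    by rewrite normrM normrN ger0_norm// ler_piMl.
  lra.
have hle t : h t <= 0.
  rewrite leNgt; apply/negP => ht.
  pose B := `|C| * 2 + `|g 1|; pose n := (Num.bound (B / h t)).
  have B0 : 0 <= B by rewrite addr_ge0 ?mulr_ge0.
  have := hbound (n%:R * t); rewrite /h gMn -[_ - _]/(n%:R * g t - n%:R * t * g 1).
  rewrite -mulrA -mulrBr -/(h t) -/B => le_n.
  have := archi_boundP (divr_ge0 B0 (ltW ht)); rewrite -/n ltr_pdivrMr//.
  by rewrite ltNge le_n.
move=> t; have := hle t; have := hle (- t); rewrite /h gN; lra.
Qed.

End Sqnorm.

(** * Hilbertian quadratic forms *)

Lemma half_scaleD (R : realType) (V : lmodType R[i]) (z : V) :
  (2^-1 : R)%:C *: z + (2^-1 : R)%:C *: z = z.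
Proof.
have h : 2^-1 + 2^-1 = 1 :> R by field.
by rewrite -scalerDl -rmorphD/= h rmorph1 scale1r.
Qed.

(** The quadratic forms of semi-inner products, characterized in the manner of
    Jordan and von Neumann.  All conditions pass to pointwise limits, which is
    why forms are handled through their quadratic forms. *)
Record hilbert_quad (R : realType) (V : lmodType R[i]) (q : V -> R) : Prop :=
  HilbertQuad {
  hq_ge0 : forall x, 0 <= q x;
  hq_para : forall x y, q (x + y) + q (x - y) = 2 * q x + 2 * q y;
  hq_scale : forall c x, q (c *: x) = sqnorm c * q x
}.

Lemma linear_ge0_eq0 (R : realType) (a b : R) :
  (forall t, 0 <= a + t * b) -> b = 0.
Proof.
move=> H; have [//|b0] := eqVneq b 0.
by have := H (- (a + 1) / b); rewrite divfK//; lra.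
Qed.

Lemma quadratic_ge0_discriminant (R : realType) (a b c : R) :
  (forall t, 0 <= a * t ^+ 2 + 2 * b * t + c) -> 0 <= a -> b ^+ 2 <= a * c.
Proof.
move=> H a0; have [a_eq0|a_neq0] := eqVneq a 0.
  have b0 : 2 * b = 0.
    by apply: (@linear_ge0_eq0 _ c) => t; have := H t; rewrite a_eq0; lra.
  by rewrite a_eq0 mul0r; have -> : b = 0; [lra | rewrite expr0n].
have a_gt0 : 0 < a by rewrite lt_def a_neq0.
have := H (- b / a).
have -> : a * (- b / a) ^+ 2 + 2 * b * (- b / a) + c = (a * c - b ^+ 2) / a by field.
by rewrite pmulr_lge0 ?invr_gt0// subr_ge0.
Qed.

(** The real part of the inner product whose quadratic form is [q]. *)
Definition repolar (R : realType) (V : lmodType R[i]) (q : V -> R) (x y : V) : R :=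
  (q (x + y) - q (x - y)) / 4.

Section Polar.
Variables (R : realType) (V : lmodType R[i]) (q : V -> R).
Hypothesis hq : hilbert_quad q.
Implicit Types x y z : V.
Local Notation r := (repolar q).

Lemma hq0 : q 0 = 0.
Proof. by rewrite -(scale0r 0) (hq_scale hq) /sqnorm /= expr0n/= addr0 mul0r. Qed.

Lemma hqN x : q (- x) = q x.
Proof. by rewrite -scaleN1r (hq_scale hq) sqnormN1 mul1r. Qed.

Lemma hqZ t x : q (t%:C *: x) = t ^+ 2 * q x.
Proof. by rewrite (hq_scale hq) sqnorm_real. Qed.

Lemma repolarC x y : r x y = r y x.
Proof. by rewrite /repolar (addrC x y) -(hqN (x - y)) opprB. Qed.

Lemma repolar0 y : r 0 y = 0.
Proof. by rewrite /repolar add0r sub0r hqN subrr mul0r. Qed.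

Lemma repolarxx x : r x x = q x.
Proof.
rewrite /repolar subrr hq0 subr0.
have -> : x + x = (2%:C : R[i]) *: x by rewrite rmorphD/= rmorph1 scalerDl scale1r.
by rewrite hqZ; field.
Qed.

(** With [x] and [x'] the half sum and half difference of [u] and [v], this is
    the difference of the parallelogram laws for [(x + y, x')] and
    [(x - y, x')]; additivity follows by comparing with the pair [(u + v, 0)]. *)
Lemma repolar_half u v y : r u y + r v y = 2 * r ((2^-1 : R)%:C *: (u + v)) y.
Proof.
set x := _ *: (u + v); set x' := ((2^-1 : R)%:C : R[i]) *: (u - v).
have -> : u = x + x'.
  by rewrite -scalerDr addrACA subrr addr0 scalerDr half_scaleD.
have -> : v = x - x'.
  by rewrite -scalerBr opprB addrC addrA subrK scalerDr half_scaleD.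
have := hq_para hq (x + y) x'; have := hq_para hq (x - y) x'.
rewrite /repolar (addrAC x y x') (addrAC x y (- x')).
by rewrite (addrAC x (- y) x') (addrAC x (- y) (- x')); lra.
Qed.

Lemma repolarDl u v y : r (u + v) y = r u y + r v y.
Proof. by rewrite repolar_half -(addr0 (u + v)) -repolar_half repolar0 !addr0. Qed.

Lemma repolarDr u v y : r y (u + v) = r y u + r y v.
Proof. by rewrite repolarC repolarDl !(repolarC y). Qed.

Lemma repolarNl u y : r (- u) y = - r u y.
Proof.
by have := repolarDl u (- u) y; rewrite subrr repolar0; lra.
Qed.

Lemma repolarNr u y : r y (- u) = - r y u.
Proof. by rewrite repolarC repolarNl (repolarC y). Qed.

Lemma repolar_le x y : 2 * r x y <= q x + q y.
Proof.
have := hq_para hq x y; have := hq_ge0 hq (x - y).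
by rewrite /repolar; lra.
Qed.

Lemma hqD x y : q (x + y) = q x + 2 * r x y + q y.
Proof. by rewrite -!repolarxx !repolarDl !repolarDr (repolarC y x); ring. Qed.

Lemma hqB x y : q (x - y) = q x - 2 * r x y + q y.
Proof. by rewrite hqD hqN repolarNr mulrN. Qed.

Lemma repolarZl t x y : r (t%:C *: x) y = t * r x y.
Proof.
rewrite -{2}(scale1r x).
apply: (@additive_quadratic_bound_linear _ (fun t : R => r (t%:C *: x) y) (q x + q y)).
  by move=> s u; rewrite rmorphD/= scalerDl repolarDl.
move=> u; have := repolar_le (u%:C *: x) y; rewrite hqZ => H.
have := hq_ge0 hq x; have := hq_ge0 hq y; have := sqr_ge0 u.
by have := repolar_le (u%:C *: x) (- y); rewrite repolarNr hqN hqZ; nra.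
Qed.

Lemma repolar_CS x y : r x y ^+ 2 <= q x * q y.
Proof.
apply: quadratic_ge0_discriminant (hq_ge0 hq x) => t.
have := hq_ge0 hq (t%:C *: x + y); rewrite hqD hqZ repolarZl; lra.
Qed.

Lemma repolarZr t x y : r x (t%:C *: y) = t * r x y.
Proof. by rewrite repolarC repolarZl repolarC. Qed.

Lemma repolarZZ c x y : r (c *: x) (c *: y) = sqnorm c * r x y.
Proof. by rewrite /repolar -scalerDr -scalerBr !(hq_scale hq) -mulrBr mulrA. Qed.

(** Homogeneity under a simultaneous scaling of both arguments is all that the
    definition gives; writing [y] as a multiple of [c] turns it into the
    adjunction. *)
Lemma repolarJ c x y : r (c *: x) y = r x (c^* *: y).
Proof.
have [->|c0] := eqVneq c 0.
  by rewrite scale0r repolar0 rmorph0 scale0r repolarC repolar0.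
have s0 : sqnorm c != 0 by apply: contra_neq c0 => /sqnorm_eq0.
have -> : y = c *: (c^-1 *: y) by rewrite scalerA divff ?scale1r.
by rewrite repolarZZ scalerA mulJc repolarZr.
Qed.

End Polar.

(** * The dual quadratic form *)

(** A conjugate-linear functional is determined by its real part, so only
    real-linear functionals with values in [R] are used. *)
Definition real_linear (R : realType) (V : lmodType R[i]) (p : V -> R) : Prop :=
  (forall x y, p (x + y) = p x + p y) /\ (forall t x, p (t%:C *: x) = t * p x).

Definition dual_bounded (R : realType) (V : lmodType R[i]) (q p : V -> R) : Prop :=
  exists C, forall g, 2 * p g - q g <= C.

(** The squared dual norm: if [a] is the supremum of [p] on the unit ball, then
    that of [2 p g - q g] is the maximum of [2 t a - t ^ 2] over [t], which is
    [a ^ 2].  Unlike the usual supremum over the unit ball, this expression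
    lets one complete squares. *)
Definition dualq (R : realType) (V : lmodType R[i]) (q p : V -> R) : R :=
  sup (range (fun g => 2 * p g - q g)).

Section Dual.
Variables (R : realType) (V : lmodType R[i]).
Implicit Types (p q : V -> R) (x y g : V).

Lemma real_linear0 p : real_linear p -> p 0 = 0.
Proof. by case=> pD _; have := pD 0 0; rewrite addr0; lra. Qed.

Lemma real_linearN p x : real_linear p -> p (- x) = - p x.
Proof. by move=> lp; have := lp.1 x (- x); rewrite subrr (real_linear0 lp); lra. Qed.

Lemma real_linear_scale p c : real_linear p -> real_linear (fun x => p (c *: x)).
Proof.
move=> [pD pZ]; split=> [x y|t x]; first by rewrite scalerDr pD.
by rewrite scalerA mulrC -scalerA pZ.
Qed.

Lemma real_linearD p1 p2 :
  real_linear p1 -> real_linear p2 -> real_linear (fun x => p1 x + p2 x).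
Proof.
move=> [D1 Z1] [D2 Z2]; split=> [x y|t x]; first by rewrite D1 D2 addrACA.
by rewrite Z1 Z2 mulrDr.
Qed.

Lemma real_linearB p1 p2 :
  real_linear p1 -> real_linear p2 -> real_linear (fun x => p1 x - p2 x).
Proof.
move=> [D1 Z1] [D2 Z2]; split=> [x y|t x]; first by rewrite D1 D2; ring.
by rewrite Z1 Z2 mulrBr.
Qed.

Lemma dualq_ub q p g : dual_bounded q p -> 2 * p g - q g <= dualq q p.
Proof.
move=> [C hC]; apply: ub_le_sup; last by exists g.
by exists C => _ [h _ <-].
Qed.

Lemma dualq_le q p C : (forall g, 2 * p g - q g <= C) -> dualq q p <= C.
Proof.
move=> hC; apply: ge_sup; first by exists (2 * p 0 - q 0), 0.
by move=> _ [h _ <-].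
Qed.

Lemma dualq_adherent q p e : dual_bounded q p -> 0 < e ->
  exists g, dualq q p - e < 2 * p g - q g.
Proof.
move=> [C hC] e0.
have hs : has_sup (range (fun g => 2 * p g - q g)).
  split; first by exists (2 * p 0 - q 0), 0.
  by exists C => _ [h _ <-].
by have [_ [g _ <-] lt_g] := sup_adherent e0 hs; exists g.
Qed.

Lemma dualq_anti q1 q2 p : (forall x, q1 x <= q2 x) -> dual_bounded q1 p ->
  dualq q2 p <= dualq q1 p.
Proof.
move=> le12 b; apply: dualq_le => g; have := dualq_ub g b; have := le12 g; lra.
Qed.

Variable q : V -> R.
Hypothesis hq : hilbert_quad q.

Lemma dualq_ge0 p : real_linear p -> dual_bounded q p -> 0 <= dualq q p.
Proof.
by move=> lp b; have := dualq_ub 0 b; rewrite (real_linear0 lp) (hq0 hq) mulr0 subrr.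
Qed.

(** The isometry [(f, h) |-> (f + h, f - h)], up to the factor 2, carries the
    parallelogram law of [q] over to its dual. *)
Lemma dual_parallelogram_id p1 p2 a b : real_linear p1 -> real_linear p2 ->
  exists f h, 2 * (p1 a + p2 a) - q a + (2 * (p1 b - p2 b) - q b) =
    2 * (2 * p1 f - q f) + 2 * (2 * p2 h - q h).
Proof.
move=> [D1 Z1] [D2 Z2].
pose f := ((2^-1 : R)%:C : R[i]) *: (a + b).
pose h := ((2^-1 : R)%:C : R[i]) *: (a - b).
exists f, h.
have ea : a = f + h by rewrite -scalerDr addrACA subrr addr0 scalerDr half_scaleD.
have eb : b = f - h.
  by rewrite -scalerBr opprB addrC addrA subrK scalerDr half_scaleD.
have N2 := @real_linearN p2 h (conj D2 Z2); have N1 := @real_linearN p1 h (conj D1 Z1).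
by have := hq_para hq f h; rewrite ea eb !D1 !D2 N1 N2; lra.
Qed.

Lemma dual_boundedD p1 p2 : real_linear p1 -> real_linear p2 ->
  dual_bounded q p1 -> dual_bounded q p2 -> dual_bounded q (fun x => p1 x + p2 x).
Proof.
move=> l1 l2 b1 b2; exists (2 * dualq q p1 + 2 * dualq q p2) => g.
have [f [h]] := dual_parallelogram_id g 0 l1 l2.
rewrite (real_linear0 l1) (real_linear0 l2) (hq0 hq).
by have := dualq_ub f b1; have := dualq_ub h b2; lra.
Qed.

Lemma dual_boundedB p1 p2 : real_linear p1 -> real_linear p2 ->
  dual_bounded q p1 -> dual_bounded q p2 -> dual_bounded q (fun x => p1 x - p2 x).
Proof.
move=> l1 l2 b1 b2; exists (2 * dualq q p1 + 2 * dualq q p2) => g.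
have [f [h]] := dual_parallelogram_id 0 g l1 l2.
rewrite (real_linear0 l1) (real_linear0 l2) (hq0 hq).
by have := dualq_ub f b1; have := dualq_ub h b2; lra.
Qed.

Lemma dual_CS p g : real_linear p -> dual_bounded q p ->
  p g ^+ 2 <= q g * dualq q p.
Proof.
move=> lp b; rewrite -sqrrN.
apply: quadratic_ge0_discriminant (hq_ge0 hq g) => t.
by have := dualq_ub (t%:C *: g) b; rewrite lp.2 (hqZ hq); lra.
Qed.

Lemma dual_scale_le p c g : real_linear p -> dual_bounded q p ->
  2 * p (c^* *: g) - q g <= sqnorm c * dualq q p.
Proof.
move=> lp b; have [->|c0] := eqVneq c 0.
  rewrite rmorph0 scale0r (real_linear0 lp) /sqnorm /= expr0n/= addr0 mul0r.
  by have := hq_ge0 hq g; lra.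
have -> : g = c *: (c^-1 *: g) by rewrite scalerA divff ?scale1r.
rewrite scalerA mulJc lp.2 (hq_scale hq) mulrCA -mulrBr.
by rewrite ler_wpM2l ?sqnorm_ge0 ?dualq_ub.
Qed.

Lemma dual_bounded_scale p c : real_linear p -> dual_bounded q p ->
  dual_bounded q (fun x => p (c^* *: x)).
Proof. by move=> lp b; exists (sqnorm c * dualq q p) => g; apply: dual_scale_le. Qed.

Lemma dualq_scale p c : real_linear p -> dual_bounded q p ->
  dualq q (fun x => p (c^* *: x)) = sqnorm c * dualq q p.
Proof.
move=> lp b; apply/eqP; rewrite eq_le; apply/andP; split.
  by apply: dualq_le => g; apply: dual_scale_le.
have [->|c0] := eqVneq c 0.
  rewrite {1}/sqnorm /= expr0n/= addr0 mul0r; apply: dualq_ge0.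
    by apply: real_linear_scale.
  exact: dual_bounded_scale.
have s0 : 0 < sqnorm c.
  by rewrite lt_def sqnorm_ge0 andbT; apply: contra_neq c0 => /sqnorm_eq0.
rewrite -ler_pdivlMl//; apply: dualq_le => g.
pose p' x := p (c^* *: x).
have -> : p g = p' (c^-1^* *: g).
  by rewrite /p' scalerA -rmorphM/= divff// rmorph1 scale1r.
have -> : (sqnorm c)^-1 = sqnorm c^-1.
  apply: (mulfI (lt0r_neq0 s0)); rewrite divff ?lt0r_neq0//.
  by rewrite -sqnormM divff// sqnorm1.
by apply: dual_scale_le; [apply: real_linear_scale | apply: dual_bounded_scale].
Qed.

Lemma dualq_para_le p1 p2 : real_linear p1 -> real_linear p2 ->
  dual_bounded q p1 -> dual_bounded q p2 ->
  dualq q (fun x => p1 x + p2 x) + dualq q (fun x => p1 x - p2 x)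
    <= 2 * dualq q p1 + 2 * dualq q p2.
Proof.
move=> l1 l2 b1 b2; rewrite -lerBrDr; apply: dualq_le => a.
rewrite lerBrDr addrC -lerBrDr; apply: dualq_le => b.
have [f [h]] := dual_parallelogram_id a b l1 l2.
by have := dualq_ub f b1; have := dualq_ub h b2; lra.
Qed.

(** The inequality applied to [p1 + p2] and [p1 - p2] is the reverse
    inequality. *)
Lemma dualq_para p1 p2 : real_linear p1 -> real_linear p2 ->
  dual_bounded q p1 -> dual_bounded q p2 ->
  dualq q (fun x => p1 x + p2 x) + dualq q (fun x => p1 x - p2 x)
    = 2 * dualq q p1 + 2 * dualq q p2.
Proof.
move=> l1 l2 b1 b2; apply/eqP; rewrite eq_le dualq_para_le//=.
have := dualq_para_le (real_linearD l1 l2) (real_linearB l1 l2)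
  (dual_boundedD l1 l2 b1 b2) (dual_boundedB l1 l2 b1 b2).
have dbl p : real_linear p -> dual_bounded q p ->
    dualq q (fun x => p x + p x) = 4 * dualq q p.
  move=> lp b; transitivity (dualq q (fun x => p ((2%:C : R[i])^* *: x))).
    congr dualq; apply/funext => x.
    by rewrite conj_real_complex lp.2; ring.
  by rewrite dualq_scale// sqnorm_real; ring.
have -> : (fun x => p1 x + p2 x + (p1 x - p2 x)) = (fun x => p1 x + p1 x).
  by apply/funext => x; ring.
have -> : (fun x => p1 x + p2 x - (p1 x - p2 x)) = (fun x => p2 x + p2 x).
  by apply/funext => x; ring.
by rewrite !dbl//; lra.
Qed.

End Dual.

(** * Newton iteration *)

Lemma cvg_eq_lim (R : realType) (T : Type) (F : set_system T) (u v : T -> R)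
    (a b : R) : ProperFilter F ->
  u x @[x --> F] --> a -> v x @[x --> F] --> b -> u =1 v -> a = b.
Proof.
by move=> FF ua vb /funext uv; move: vb; rewrite -uv; apply: cvg_unique ua.
Qed.

(** The real part of a form that is linear in its first argument and hermitian. *)
Record hermitian_real_part (R : realType) (V : lmodType R[i]) (k : V -> V -> R) :
    Prop := HermitianRealPart {
  hrp_linear : forall x, real_linear (k x);
  hrp_sym : forall x y, k x y = k y x;
  hrp_conj : forall c x y, k (c *: x) y = k x (c^* *: y)
}.

Definition majorant (R : realType) (V : lmodType R[i]) (k : V -> V -> R)
    (q : V -> R) : Prop :=
  hilbert_quad q /\ forall x, `|k x x| <= q x.

Section Newton.
Variables (R : realType) (V : lmodType R[i]) (k : V -> V -> R).
Hypothesis hk : hermitian_real_part k.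
Implicit Types (q : V -> R) (x y : V).

Lemma hrpDl x y z : k (x + y) z = k x z + k y z.
Proof. by rewrite !(hrp_sym hk _ z) (hrp_linear hk z).1. Qed.

Lemma hrpNl x z : k (- x) z = - k x z.
Proof. by rewrite !(hrp_sym hk _ z) (real_linearN _ (hrp_linear hk z)). Qed.

Lemma hrpDr x y z : k z (x + y) = k z x + k z y.
Proof. exact: (hrp_linear hk z).1. Qed.

Lemma hrpNr x z : k z (- x) = - k z x.
Proof. exact: (real_linearN _ (hrp_linear hk z)). Qed.

(** Polarization: [4 k(x, y) = k(x + y, x + y) - k(x - y, x - y)], and the
    parallelogram law of [q] bounds the right-hand side. *)
Lemma majorant_le q x y : majorant k q -> 2 * k x y <= q x + q y.
Proof.
move=> [hq le_k]; have := hq_para hq x y.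
have := le_k (x + y); have := le_k (x - y); rewrite !ler_norml.
rewrite !(hrpDl, hrpNl, hrpDr, hrpNr) (hrp_sym hk y x) => /andP[H1 H2] /andP[H3 H4].
by lra.
Qed.

Lemma majorant_bounded q x : majorant k q -> dual_bounded q (k x).
Proof.
by move=> mq; exists (q x) => y; rewrite lerBlDr; apply: majorant_le.
Qed.

Lemma dual_majorant_le q x : majorant k q -> dualq q (k x) <= q x.
Proof.
by move=> mq; apply: dualq_le => y; rewrite lerBlDr; apply: majorant_le.
Qed.

Lemma hilbert_quad_dual q : majorant k q -> hilbert_quad (fun x => dualq q (k x)).
Proof.
move=> mq; have [hq _] := mq; have l := hrp_linear hk.
split=> [x|x y|c x]; first exact: dualq_ge0 (majorant_bounded x mq).
  rewrite -dualq_para//; [congr (dualq q _ + dualq q _)|exact: majorant_bounded..];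
    by apply/funext => z; rewrite hrpDl ?hrpNl.
rewrite -dualq_scale//; last exact: majorant_bounded.
by congr dualq; apply/funext => z; rewrite (hrp_conj hk).
Qed.

(** If [k] is represented by [G] with respect to an inner product in which [q]
    is given by the positive operator [M], this is
    [M |-> (M + G M^-1 G) / 2], Newton's iteration for the absolute value
    of [G]. *)
Definition newton_step q x := (q x + dualq q (k x)) / 2.

Lemma newton_step_le q x : majorant k q -> newton_step q x <= q x.
Proof. by move=> mq; have := dual_majorant_le x mq; rewrite /newton_step; lra. Qed.

(** Domination comes from the values [g = x] and [g = - x] in the supremum
    defining the dual form. *)
Lemma majorant_newton_step q : majorant k q -> majorant k (newton_step q).
Proof.
move=> mq; have [hq _] := mq; have hd := hilbert_quad_dual mq.
rewrite /newton_step; split; first split=> [x|x y|c x].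
- by have := hq_ge0 hq x; have := hq_ge0 hd x; lra.
- by have := hq_para hq x y; have := hq_para hd x y; lra.
- by rewrite (hq_scale hq) (hq_scale hd); lra.
move=> x; have := dualq_ub x (majorant_bounded x mq).
have := dualq_ub (- x) (majorant_bounded x mq).
by rewrite ler_norml hrpNr (hqN hq) => *; apply/andP; split; lra.
Qed.

(** The dual form increases when the form decreases.  With [q'] the limit of
    the iterates [u n], this gives
    [dualq q' (k x) >= dualq (u n) (k x) = 2 u (n + 1) x - u n x], and the right
    side tends to [q' x]. *)
Lemma exists_selfdual_majorant q : majorant k q ->
  exists2 q', majorant k q' & forall x, dualq q' (k x) = q' x.
Proof.
move=> mq; pose u n := iter n newton_step q.
have mu n : majorant k (u n) by elim: n => //= n; apply: majorant_newton_step.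
have uS n x : u n.+1 x <= u n x by apply: newton_step_le.
pose ql x := limn (fun n => u n x).
have cu x : u n x @[n --> \oo] --> ql x.
  apply: nonincreasing_is_cvgn; first by apply/nonincreasing_seqP => n; apply: uS.
  by exists 0 => _ [n _ <-]; apply: (hq_ge0 (mu n).1).
have mql : majorant k ql.
  split; first split=> [x|x y|c x].
  - by apply: limr_ge; [apply: cu|near=> n; apply: (hq_ge0 (mu n).1)].
  - apply: (@cvg_eq_lim _ _ \oo); [by apply: cvgD; apply: cu|..].
      by apply: cvgD; apply: cvgMl_tmp; apply: cu.
    by move=> n; apply: (hq_para (mu n).1).
  - apply: (@cvg_eq_lim _ _ \oo); [exact: cu|by apply: cvgMl_tmp; apply: cu|].
    by move=> n; apply: (hq_scale (mu n).1).
  - by move=> x; apply: limr_ge; [apply: cu|near=> n; apply: (mu n).2].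
exists ql => // x; apply/eqP; rewrite eq_le dual_majorant_le//=.
have le_u n y : ql y <= u n y.
  apply: limr_le; first exact: cu.
  near=> m; have /nonincreasing_seqP ni : forall m, u m.+1 y <= u m y by move=> ?; apply: uS.
  by apply: (ni n m); near: m; apply: nbhs_infty_ge.
have cd : (2 * u n.+1 x - u n x) @[n --> \oo] --> 2 * ql x - ql x.
  by apply: cvgB (cu x); apply: cvgMl_tmp; rewrite (cvg_shiftS (fun n => u n x)).
have {1}-> : ql x = 2 * ql x - ql x by ring.
rewrite -(cvg_lim _ cd)//; apply: limr_le; first by apply: cvgP cd.
near=> n; have := @dualq_anti _ _ ql (u n) (k x) (le_u n) (majorant_bounded x mql).
by rewrite /= /newton_step; lra.
Unshelve. all: by end_near. Qed.

End Newton.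

(** * The dual Hilbert space *)

Record hilbert_form (R : realType) (V : lmodType R[i]) := HilbertForm {
  hilbert_form_fun :> V -> R;
  hilbert_formP : hilbert_quad hilbert_form_fun
}.

(** The antidual of [(V, q)], which serves as its completion; see [embed] and
    [dense_embed].  Each conjugate-linear functional is stored as its real part,
    so [c *: x] is the functional [g |-> x (c^* *: g)]. *)
Record dual_space (R : realType) (V : lmodType R[i]) (q : hilbert_form V) :=
  DualSpace {
  dual_fun :> V -> R;
  dual_lin : real_linear dual_fun;
  dual_bnd : dual_bounded q dual_fun
}.

HB.instance Definition _ (R : realType) (V : lmodType R[i]) (q : hilbert_form V) :=
  gen_eqMixin (dual_space q).
HB.instance Definition _ (R : realType) (V : lmodType R[i]) (q : hilbert_form V) :=
  gen_choiceMixin (dual_space q).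

Section DualSpace.
Variables (R : realType) (V : lmodType R[i]) (q : hilbert_form V).
Local Notation H := (dual_space q).
Local Notation hq := (hilbert_formP q).
Implicit Types (x y z : H) (g : V).

Lemma dual_ext x y : x =1 y -> x = y.
Proof.
case: x y => [p lp bp] [p' lp' bp'] /funext /= e; move: lp bp; rewrite e => lp bp.
by congr DualSpace; apply: Prop_irrelevance.
Qed.

Definition dual0 : H.
Proof.
apply: (@DualSpace _ _ _ (fun=> 0)); first by split=> *; rewrite ?addr0 ?mulr0.
by exists 0 => g; have := hq_ge0 hq g; lra.
Defined.

Definition dual_scale (c : R[i]) x : H :=
  DualSpace (real_linear_scale (c^*) (dual_lin x))
    (dual_bounded_scale hq c (dual_lin x) (dual_bnd x)).

Definition dual_add x y : H :=
  DualSpace (real_linearD (dual_lin x) (dual_lin y))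
    (dual_boundedD hq (dual_lin x) (dual_lin y) (dual_bnd x) (dual_bnd y)).

Definition dual_opp x : H := dual_scale (-1) x.

Fact dual_addA : associative dual_add.
Proof. by move=> x y z; apply: dual_ext => g /=; rewrite addrA. Qed.
Fact dual_addC : commutative dual_add.
Proof. by move=> x y; apply: dual_ext => g /=; rewrite addrC. Qed.
Fact dual_add0 : left_id dual0 dual_add.
Proof. by move=> x; apply: dual_ext => g /=; rewrite add0r. Qed.
Fact dual_oppE x g : dual_opp x g = - x g.
Proof.
by rewrite /dual_opp /dual_scale /= rmorphN1 scaleN1r (real_linearN _ (dual_lin x)).
Qed.
Fact dual_addN : left_inverse dual0 dual_opp dual_add.
Proof.
by move=> x; apply: dual_ext => g; rewrite -[LHS]/(dual_opp x g + x g) dual_oppE addNr.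
Qed.

HB.instance Definition _ :=
  GRing.isZmodule.Build H dual_addA dual_addC dual_add0 dual_addN.

Fact dual_scaleA c d x : dual_scale c (dual_scale d x) = dual_scale (c * d) x.
Proof. by apply: dual_ext => g /=; rewrite scalerA rmorphM mulrC. Qed.
Fact dual_scale1 : left_id 1 dual_scale.
Proof. by move=> x; apply: dual_ext => g /=; rewrite rmorph1 scale1r. Qed.
Fact dual_scaleDr : right_distributive dual_scale +%R.
Proof. by move=> c x y; apply: dual_ext. Qed.
Fact dual_scaleDl x : {morph dual_scale^~ x : c d / c + d}.
Proof.
by move=> c d; apply: dual_ext => g /=; rewrite rmorphD scalerDl (dual_lin x).1.
Qed.

HB.instance Definition _ := GRing.Zmodule_isLmodule.Build R[i] H
  dual_scaleA dual_scale1 dual_scaleDr dual_scaleDl.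

Lemma dualDE x y g : (x + y) g = x g + y g. Proof. by []. Qed.
Lemma dualNE x g : (- x) g = - x g. Proof. exact: dual_oppE. Qed.
Lemma dualBE x y g : (x - y) g = x g - y g. Proof. by rewrite dualDE dualNE. Qed.

Definition dquad x : R := dualq q x.

Lemma hilbert_quad_dquad : hilbert_quad dquad.
Proof.
split=> [x|x y|c x].
- exact: (dualq_ge0 hq (dual_lin x) (dual_bnd x)).
- have -> : dquad (x - y) = dualq q (fun g => x g - y g).
    by congr dualq; apply/funext => g; rewrite dualBE.
  exact: (dualq_para hq (dual_lin x) (dual_lin y) (dual_bnd x) (dual_bnd y)).
- exact: (dualq_scale hq c (dual_lin x) (dual_bnd x)).
Qed.
Local Notation hQ := hilbert_quad_dquad.

Lemma dquad_ub x g : 2 * x g - q g <= dquad x.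
Proof. exact: dualq_ub (dual_bnd x). Qed.

Lemma dquad_eq0 x : dquad x = 0 -> x = 0.
Proof.
move=> x0; apply: dual_ext => g.
have := dual_CS hq g (dual_lin x) (dual_bnd x).
rewrite -/(dquad x) x0 mulr0 => le0.
have : x g ^+ 2 == 0 by rewrite eq_le le0 sqr_ge0.
by rewrite sqrf_eq0 => /eqP.
Qed.

Definition dual_norm x : R[i] := (Num.sqrt (dquad x))%:C.

Lemma dual_normD x y : dual_norm (x + y) <= dual_norm x + dual_norm y.
Proof.
rewrite -rmorphD/= lecR.
have X0 := hq_ge0 hQ x; have Y0 := hq_ge0 hQ y.
have S0 : 0 <= Num.sqrt (dquad x) + Num.sqrt (dquad y) by rewrite addr_ge0 ?sqrtr_ge0.
rewrite -(ger0_norm S0) -sqrtr_sqr ler_sqrt ?sqr_ge0//.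
rewrite (hqD hQ) sqrrD !sqr_sqrtr// -sqrtrM// lerD2r lerD2l -[leRHS]mulr_natl.
rewrite ler_pM2l//; apply: le_trans (ler_norm _) _.
by rewrite -sqrtr_sqr ler_wsqrtr// (repolar_CS hQ).
Qed.

Lemma dual_normZ c x : dual_norm (c *: x) = `|c| * dual_norm x.
Proof.
by rewrite /dual_norm (hq_scale hQ) sqrtrM ?sqnorm_ge0// rmorphM/= normc_def.
Qed.

Lemma dual_norm_eq0 x : dual_norm x = 0 -> x = 0.
Proof.
move/eqP; rewrite eq_complex /= eqxx andbT sqrtr_eq0 => le0.
by apply: dquad_eq0; apply/eqP; rewrite eq_le le0 (hq_ge0 hQ).
Qed.

HB.instance Definition _ :=
  Lmodule_isNormed.Build R[i] H dual_normD dual_normZ dual_norm_eq0.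

Lemma dual_normE x : `|x| = (Num.sqrt (dquad x))%:C.
Proof. by []. Qed.

Lemma dual_norm_sqr x : `|x| ^+ 2 = (dquad x)%:C.
Proof. by rewrite dual_normE -rmorphXn/= sqr_sqrtr// (hq_ge0 hQ). Qed.

Lemma dual_ballE x (e : R) y : 0 < e -> ball x e%:C y <-> dquad (x - y) < e ^+ 2.
Proof.
move=> e0; rewrite -ball_normE /ball_ /= dual_normE ltcR.
rewrite -{1}(gtr0_norm e0) -sqrtr_sqr ltr_sqrt ?exprn_gt0//.
Qed.

Lemma dquad_triangle x y z (e : R) : 0 < e ->
  dquad (x - y) < e ^+ 2 -> dquad (x - z) < e ^+ 2 -> dquad (y - z) < (2 * e) ^+ 2.
Proof.
move=> e0 h1 h2; have -> : y - z = (x - z) - (x - y) by rewrite opprB [RHS]addrC addrA subrK.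
by have := hq_para hQ (x - z) (x - y); have := hq_ge0 hQ (x - z + (x - y)); lra.
Qed.

Lemma cauchy_dual_ex (F : set_system H) : ProperFilter F -> cauchy F ->
  forall e : R, 0 < e -> exists x, \forall y \near F, dquad (x - y) < e ^+ 2.
Proof.
move=> FF cF e e0; have /cauchyP/(_ e%:C) := cF.
rewrite ltcR => /(_ e0)[x Fx]; exists x.
by apply: filterS Fx => y /(dual_ballE _ _ e0).
Qed.

Lemma cauchy_dual_eval (F : set_system H) g : ProperFilter F -> cauchy F ->
  cvg (x g @[x --> F]).
Proof.
move=> FF cF; apply: R_complete; apply/cauchyP => e e0.
have s0 : 0 < q g + 1 by have := hq_ge0 hq g; lra.
have e1 : 0 < e / (q g + 1) by rewrite divr_gt0.
have [x Fx] := cauchy_dual_ex FF cF e1.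
exists (x g); rewrite /fmap /nbhs /= -ball_normE /=; near=> y => /=.
rewrite -dualBE -sqrtr_sqr -(gtr0_norm e0) -[ltRHS]sqrtr_sqr ltr_sqrt ?exprn_gt0//.
apply: le_lt_trans (dual_CS hq g (dual_lin _) (dual_bnd _)) _.
have xy : dquad (x - y) < (e / (q g + 1)) ^+ 2 by near: y.
have -> : e ^+ 2 = (q g + 1) ^+ 2 * (e / (q g + 1)) ^+ 2 by field; lra.
have Q0 := hq_ge0 hQ (x - y); have q0 := hq_ge0 hq g.
rewrite -/(dquad _).
apply: (@le_lt_trans _ _ ((q g + 1) ^+ 2 * dquad (x - y))).
  by apply: ler_wpM2r => //; nra.
by rewrite ltr_pM2l ?exprn_gt0.
Unshelve. all: by end_near. Qed.

(** A Cauchy filter converges pointwise to a functional [l], and the bounds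
    [2 (y - x) g - q g <= e] that express smallness in norm are preserved when
    [x] tends to [l] pointwise. *)
Lemma dual_complete (F : set_system H) : ProperFilter F -> cauchy F -> cvg F.
Proof.
move=> FF cF; pose l g := lim (x g @[x --> F]).
have cl g : x g @[x --> F] --> l g by apply: cauchy_dual_eval.
have lin_l : real_linear l.
  split=> [g h|t g].
    apply: (@cvg_eq_lim _ _ F); [exact: cl|by apply: cvgD; apply: cl|].
    by move=> x; rewrite /= (dual_lin x).1.
  apply: (@cvg_eq_lim _ _ F); [exact: cl|by apply: cvgMl_tmp; apply: cl|].
  by move=> x; rewrite /= (dual_lin x).2.
(* norm bounds survive the passage to the pointwise limit *)
have le_l (y : H) (C : R) g : (\forall x \near F, 2 * (y - x) g - q g <= C) ->
    2 * (y g - l g) - q g <= C.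
  move=> hC; have cl' : 2 * (y g - x g) - q g @[x --> F] --> 2 * (y g - l g) - q g.
    apply: cvgB; last exact: cvg_cst.
    by apply: cvgMl_tmp; apply: cvgB; [exact: cvg_cst|exact: cl].
  rewrite -(cvg_lim _ cl')//; apply: limr_le; first by apply: cvgP cl'.
  by apply: filterS hC => x; rewrite dualBE.
(* one ball of the filter bounds the norms of its elements *)
have bnd_l : dual_bounded q l.
  have [x Fx] := cauchy_dual_ex FF cF ltr01.
  exists (2 * dquad x + 2) => g.
  suff : 2 * ((0 : H) (- g) - l (- g)) - q (- g) <= 2 * dquad x + 2.
    by rewrite (hqN hq) (real_linearN _ lin_l) -[(0 : H) _]/(0 : R) sub0r opprK.
  apply: le_l; apply: filterS Fx => y xy; apply: (le_trans (dquad_ub _ _)).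
  have e : x - (x - y) = y by rewrite opprB addrC subrK.
  rewrite sub0r (hqN hQ); have := hq_para hQ x (x - y); rewrite e.
  by have := hq_ge0 hQ (x + (x - y)); lra.
pose L := DualSpace lin_l bnd_l.
(* radius 3 r leaves room for the distances 2 r between elements of a ball,
   the strict bound being weakened in the limit *)
apply/cvg_ex; exists L; apply/cvg_ballP => e e0.
have [r r0 re] : exists2 r : R, 0 < r & (3 * r)%:C <= e.
  move: e0; case: e => a b; rewrite ltcE /= => /andP[/eqP-> a0].
  by exists (a / 3); [lra|rewrite lecE /= eqxx/=; lra].
have [x Fx] := cauchy_dual_ex FF cF r0.
near=> y; apply: (le_ball re); apply/dual_ballE; first by lra.
rewrite -(hqN hQ) opprB; apply: (@le_lt_trans _ _ ((2 * r) ^+ 2)); last by nra.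
apply: dualq_le => g; rewrite dualBE; apply: le_l; near=> z.
apply: (le_trans (dquad_ub _ _)); apply: ltW; apply: (@dquad_triangle x) => //.
  by near: y.
by near: z.
Unshelve. all: by end_near. Qed.

HB.instance Definition _ := Uniform_isComplete.Build H dual_complete.

End DualSpace.

(** * Inner products *)

(** The imaginary part of [<x, y>] is the real part of [<x, 'i y>], the form
    being conjugate-linear in [y]. *)
Definition inner (R : realType) (W : lmodType R[i]) (Q : W -> R) (x y : W) : R[i] :=
  Complex (repolar Q x y) (repolar Q x ((Complex 0 1) *: y)).

Section Inner.
Variables (R : realType) (W : lmodType R[i]) (Q : W -> R).
Hypothesis hQ : hilbert_quad Q.
Implicit Types (x y z : W).
Local Notation r := (repolar Q).

Lemma repolar_mulr c x y : r x (c *: y) = Re c * r x y + Im c * r x ((Complex 0 1) *: y).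
Proof.
rewrite {1}(complexE c) scalerDl mulrC -scalerA (repolarDr hQ) !(repolarZr hQ) //.
Qed.

Lemma repolar_mull c x y : r (c *: x) y = Re c * r x y - Im c * r x ((Complex 0 1) *: y).
Proof. by rewrite (repolarJ hQ) repolar_mulr; case: c => a b /=; rewrite mulNr. Qed.

Lemma inner_linearl z : scalar (inner Q ^~ z).
Proof.
move=> c x y; apply/eqP; rewrite eq_complex /inner /=.
have ii (u : W) : Complex 0 1 *: (Complex 0 1 *: u) = - u.
  by rewrite scalerA -expr2 sqr_i scaleN1r.
rewrite !(repolarDl hQ) !repolar_mull ii (repolarNr hQ).
by case: c => a b /=; apply/andP; split; apply/eqP; ring.
Qed.

Lemma innerC x y : inner Q x y = (inner Q y x)^*.
Proof.
apply/eqP; rewrite eq_complex /inner /=; apply/andP; split; apply/eqP.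
  exact: repolarC.
by rewrite (repolarC hQ) repolar_mull /= mul0r sub0r mul1r.
Qed.

Lemma inner_self x : inner Q x x = (Q x)%:C.
Proof.
apply/eqP; rewrite eq_complex /inner /= (repolarxx hQ) eqxx /=.
have := repolar_mull (Complex 0 1) x x; rewrite (repolarC hQ) /=.
by rewrite mul0r mul1r => ?; apply/eqP; lra.
Qed.

End Inner.

Section DualInner.
Variables (R : realType) (V : lmodType R[i]) (q : hilbert_form V).
Local Notation H := (dual_space q).
Local Notation hq := (hilbert_formP q).
Local Notation hQ := (hilbert_quad_dquad q).
Local Notation Q := (@dquad R V q).
Implicit Types (x y z : H) (g h : V).

Definition dual_inner : H -> H -> R[i] := inner Q.

Fact dual_inner_bilinear :
  bilinear_for *%R (conjC \; *%R) (dual_inner : H -> H -> R[i]).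
Proof.
split=> [z|z]; first exact: (inner_linearl hQ).
move=> c x y /=; rewrite /dual_inner !(innerC hQ z) (inner_linearl hQ).
by rewrite rmorphD rmorphM.
Qed.
HB.instance Definition _ := bilinear_isBilinear.Build R[i] H H R[i]
  *%R (conjC \; *%R) dual_inner dual_inner_bilinear.

Fact dual_inner_herm x y : dual_inner x y = (-1) ^+ false * (dual_inner y x)^*.
Proof. by rewrite expr0 mul1r; apply: (innerC hQ). Qed.
HB.instance Definition _ :=
  isHermitianSesquilinear.Build R[i] H false conjC dual_inner dual_inner_herm.

Fact dual_inner_gt0 x : x != 0 -> 0 < dual_inner x x.
Proof.
move=> x0; rewrite /dual_inner (inner_self hQ) ltcR lt_def (hq_ge0 hQ) andbT.
by apply: contra_neq x0 => /dquad_eq0.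
Qed.
HB.instance Definition _ := isDotProduct.Build R[i] H dual_inner dual_inner_gt0.

Lemma repolar_real_linear g : real_linear (repolar q g).
Proof. by split=> *; [apply: (repolarDr hq)|apply: (repolarZr hq)]. Qed.

Lemma repolar_dual_bounded g : dual_bounded q (repolar q g).
Proof. by exists (q g) => h; rewrite lerBlDr; apply: (repolar_le hq). Qed.

(** The Riesz map [g |-> <g, .>]. *)
Definition embed g : H := DualSpace (repolar_real_linear g) (repolar_dual_bounded g).

Fact embed_linear : linear embed.
Proof.
move=> c g h; apply: dual_ext => u /=.
by rewrite (repolarDl hq) (repolarJ hq).
Qed.
HB.instance Definition _ := GRing.isLinear.Build R[i] V H _ embed embed_linear.

(** Replace [g] by [g + h] in the supremum that defines the dual norm of
    [x - embed h].  The identity says that nearly maximizing [2 x h - q h] is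
    the same as nearly approximating [x] by [embed h]. *)
Lemma dquadB_embed x h : Q (x - embed h) = Q x - (2 * x h - q h).
Proof.
have le (y : H) (g : V) : Q (y - embed g) <= Q y - (2 * y g - q g).
  apply: dualq_le => u; rewrite dualBE /=.
  have := dquad_ub y (u + g); rewrite (hqD hq) (dual_lin y).1 (repolarC hq u); lra.
apply/eqP; rewrite eq_le le /=.
have := le (x - embed h) (- h); rewrite raddfN opprK subrK dualBE.
rewrite (real_linearN _ (dual_lin x)) /= (repolarNr hq) (repolarxx hq) (hqN hq); lra.
Qed.

Lemma dquad_embed h : Q (embed h) = q h.
Proof.
have := dquadB_embed 0 h; rewrite sub0r (hqN hQ) (hq0 hQ) => ->.
by rewrite -[(0 : H) h]/(0 : R); lra.
Qed.

(** The Riesz representation: evaluation at [h] is the inner product with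
    [embed h]. *)
Lemma repolar_embed x h : repolar Q x (embed h) = x h.
Proof. by have := hqB hQ x (embed h); rewrite dquadB_embed dquad_embed; lra. Qed.

Lemma dense_embed : dense (range embed).
Proof.
move=> O [x Ox] oO.
have /nbhs_ballP[e /= e0 eO] : nbhs x O by apply: open_nbhs_nbhs.
have [r r0 re] : exists2 r : R, 0 < r & r%:C <= e.
  move: e0 {eO}; case: e => a b; rewrite ltcE /= => /andP[/eqP-> a0].
  by exists a => //; rewrite lecE /= eqxx/=.
have r2 : 0 < r ^+ 2 by rewrite exprn_gt0.
have [h hr] := dualq_adherent (dual_bnd x) r2.
exists (embed h); split; last by exists h.
apply: eO; apply: (le_ball re); apply/dual_ballE => //.
by rewrite dquadB_embed -/(Q x) in hr *; lra.
Qed.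

(** * The symmetry *)
Variable k : V -> V -> R.
Hypotheses (hk : hermitian_real_part k) (mq : majorant k q).

(** The functional [k h], seen in the Hilbert space: the image of [embed h]
    under the operator that represents [k] (see [symmetry_embed]). *)
Definition gram h : H := DualSpace (hrp_linear hk h) (majorant_bounded hk h mq).

Lemma gramD g h : gram (g + h) = gram g + gram h.
Proof. by apply: dual_ext => u; apply: (hrpDl hk). Qed.
Lemma gramZ c g : gram (c *: g) = c *: gram g.
Proof. by apply: dual_ext => u; apply: (hrp_conj hk). Qed.

Lemma gram_real_linear x : real_linear (fun h => repolar Q x (gram h)).
Proof.
split=> *; first by rewrite gramD (repolarDr hQ).
by rewrite gramZ (repolarZr hQ).
Qed.

Lemma gram_dual_le x h : 2 * repolar Q x (gram h) - q h <= Q x.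
Proof.
rewrite lerBlDr; apply: le_trans (repolar_le hQ _ _) _; rewrite lerD2l.
exact: (dual_majorant_le hk).
Qed.

(** The operator that represents [k], extended to the whole space through its
    adjoint: [<symmetry x, embed h> = <x, gram h>]. *)
Definition symmetry x : H :=
  DualSpace (gram_real_linear x) (ex_intro _ (Q x) (gram_dual_le x)).

Fact symmetry_linear : linear symmetry.
Proof.
move=> c x y; apply: dual_ext => h /=.
by rewrite (repolarDl hQ) (repolarJ hQ) gramZ.
Qed.
HB.instance Definition _ := GRing.isLinear.Build R[i] H H _ symmetry symmetry_linear.

Lemma symmetry_le x : Q (symmetry x) <= Q x.
Proof. exact: dualq_le (gram_dual_le x). Qed.

Lemma symmetry_embed h : symmetry (embed h) = gram h.
Proof.
apply: dual_ext => g /=; rewrite (repolarC hQ) repolar_embed /=.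
exact: (hrp_sym hk).
Qed.

(** For a fixed point of the dual form the contraction [symmetry] is isometric
    on the range of [embed]. *)
Hypothesis qE : forall h, dualq q (k h) = q h.

(** A contraction [T] which is isometric on [y] satisfies
    [<T x, T y> = <x, y>] for all [x]: the function
    [Q (x + t y) - Q (T x + t T y)] of [t] is nonnegative and affine, hence
    constant. *)
Lemma repolar_symmetry_gram x h : repolar Q (symmetry x) (gram h) = x h.
Proof.
rewrite -(repolar_embed x h).
have : 2 * (repolar Q x (embed h) - repolar Q (symmetry x) (gram h)) = 0; last by lra.
apply: (@linear_ge0_eq0 _ (Q x - Q (symmetry x))) => t.
have := symmetry_le (x + t%:C *: embed h).
rewrite linearD linearZ /= symmetry_embed !(hqD hQ) !(hqZ hQ) !(repolarZr hQ).
rewrite dquad_embed; have -> : Q (gram h) = q h by apply: qE.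
lra.
Qed.

Lemma symmetryK : cancel symmetry symmetry.
Proof. by move=> x; apply: dual_ext => h; apply: repolar_symmetry_gram. Qed.

(** A contraction which is its own inverse is isometric. *)
Lemma symmetry_isometry x : Q (symmetry x) = Q x.
Proof.
apply/eqP; rewrite eq_le symmetry_le /=.
by rewrite -{1}(symmetryK x) symmetry_le.
Qed.

Lemma symmetry_adj x y : dual_inner (symmetry x) y = dual_inner x (symmetry y).
Proof.
have iso u v : repolar Q (symmetry u) v = repolar Q u (symmetry v).
  by rewrite -{1}(symmetryK v) /repolar -linearD -linearB !symmetry_isometry.
by apply/eqP; rewrite eq_complex /dual_inner /inner /= iso eqxx /= iso linearZ.
Qed.

Definition dual_krein_form x y := dual_inner (symmetry x) y.

Lemma dual_kreinP : krein_axiom dual_krein_form.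
Proof.
exists dual_inner, symmetry; split => //.
- by move=> x; rewrite dual_norm_sqr -(inner_self hQ).
- exact: symmetry_adj.
- exact: symmetryK.
Qed.

Definition dual_krein : kreinSpace R := KreinSpace dual_kreinP.

End DualInner.

(** Once the majorant is self-dual, the operator that represents [k] in its
    completion is a symmetry, and so defines a Krein space.  The two real
    components on the right are the real and imaginary parts of the hermitian
    form with real part [k]. *)
Theorem krein_space_of_majorant (R : realType) (V : lmodType R[i])
    (k : V -> V -> R) (q : V -> R) : hermitian_real_part k -> majorant k q ->
  exists (K : kreinSpace R) (v : {linear V -> K}),
    dense (range v) /\
    forall f g, krein_form (v f) (v g) = Complex (k f g) (k f (Complex 0 1 *: g)).
Proof.
move=> hk /(exists_selfdual_majorant hk)[q' mq' q'E].
pose Q := HilbertForm mq'.1.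
exists (dual_krein hk (mq' : majorant k Q) q'E), (embed Q).
split; first exact: dense_embed.
move=> f g; rewrite /krein_form /= /dual_krein_form symmetry_embed /dual_inner /inner.
by rewrite -linearZ !repolar_embed.
Qed.

(** * Hermitian sesquilinear forms *)

Record hermitian_form (R : realType) (V : lmodType R[i]) (B : V -> V -> R[i]) :
    Prop := HermitianForm {
  hf_linear : forall z, scalar (B ^~ z);
  hf_sym : forall x y, B x y = (B y x)^*
}.

Section HermitianForm.
Variables (R : realType) (V : lmodType R[i]) (B : V -> V -> R[i]).
Hypothesis hB : hermitian_form B.
Implicit Types (x y z : V) (c : R[i]).

Lemma hfDl x y z : B (x + y) z = B x z + B y z.
Proof. by have := hf_linear hB z 1 x y; rewrite scale1r mul1r. Qed.

Lemma hf0l z : B 0 z = 0.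
Proof. by apply: (addrI (B 0 z)); rewrite -hfDl !addr0. Qed.

Lemma hfZl c x z : B (c *: x) z = c * B x z.
Proof. by have := hf_linear hB z c x 0; rewrite hf0l !addr0. Qed.

Lemma hfNl x z : B (- x) z = - B x z.
Proof. by rewrite -scaleN1r hfZl mulN1r. Qed.

Lemma hfDr x y z : B z (x + y) = B z x + B z y.
Proof. by rewrite !(hf_sym hB z) hfDl rmorphD. Qed.

Lemma hfZr c x z : B z (c *: x) = c^* * B z x.
Proof. by rewrite !(hf_sym hB z) hfZl rmorphM. Qed.

Lemma hfNr x z : B z (- x) = - B z x.
Proof. by rewrite -scaleN1r hfZr rmorphN1 mulN1r. Qed.

Lemma hf0r z : B z 0 = 0.
Proof. by rewrite (hf_sym hB) hf0l rmorph0. Qed.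

Lemma hf_suml I (s : seq I) (F : I -> V) z :
  B (\sum_(i <- s) F i) z = \sum_(i <- s) B (F i) z.
Proof.
by elim: s => [|i s IHs]; rewrite ?big_nil ?hf0l// !big_cons hfDl IHs.
Qed.

Lemma hf_sumr I (s : seq I) (F : I -> V) z :
  B z (\sum_(i <- s) F i) = \sum_(i <- s) B z (F i).
Proof.
by elim: s => [|i s IHs]; rewrite ?big_nil ?hf0r// !big_cons hfDr IHs.
Qed.

Lemma hf_hermitian_real_part : hermitian_real_part (fun x y => Re (B x y)).
Proof.
split=> [x|x y|c x y]; first split=> [y z|t y].
- by rewrite hfDr raddfD.
- by rewrite hfZr; case: (B x y) => a b /=; ring.
- by rewrite (hf_sym hB); case: (B y x).
- by rewrite hfZl hfZr conjCK.
Qed.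

Lemma hf_hilbert_quad : (forall x, 0 <= B x x) -> hilbert_quad (fun x => Re (B x x)).
Proof.
move=> B0; split=> [x|x y|c x].
- by have := B0 x; rewrite lecE => /andP[].
- rewrite !(hfDl, hfDr, hfNl, hfNr) !raddfD /=; ring.
- rewrite hfZl hfZr mulrA mulcJ; case: (B x x) => a b /=; ring.
Qed.

Lemma hf_repolar x y : repolar (fun x => Re (B x x)) x y = Re (B x y).
Proof.
rewrite /repolar !(hfDl, hfDr, hfNl, hfNr) !raddfD /= (hf_sym hB y x).
by case: (B x y) (B x x) (B y y) => a b [c d] [e f] /=; field.
Qed.

(** The real Cauchy-Schwarz inequality for [x] and [B x y *: y]: the scalar
    rotates the inner product onto the real axis. *)
Lemma hf_CS x y : (forall x, 0 <= B x x) ->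
  sqnorm (B x y) <= Re (B x x) * Re (B y y).
Proof.
move=> B0; have hq := hf_hilbert_quad B0.
have := repolar_CS hq x (B x y *: y); rewrite hf_repolar (hq_scale hq) hfZr mulJc /=.
set a := sqnorm _; have a0 : 0 <= a := sqnorm_ge0 _.
have [->|an0] := eqVneq a 0; first by rewrite mulr_ge0 ?(hq_ge0 hq).
have a_gt0 : 0 < a by rewrite lt_def an0.
by rewrite mulrCA expr2 ler_pM2l.
Qed.

End HermitianForm.

Lemma hermitian_form_dot (R : realType) (V : lmodType R[i])
    (ip : {dot V for conjC}) : hermitian_form ip.
Proof.
split=> [z c x y|x y]; first by rewrite linearDl linearZl_LR.
by rewrite hermC expr0 mul1r.
Qed.

(** * Krein spaces *)

Section Krein.
Variables (R : realType) (K : kreinSpace R).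
Implicit Types (x y z : K) (D : set K).
Local Notation br := (@krein_form R K).

Lemma krein_hermitian_form : hermitian_form br.
Proof.
have [ip [J [_ Jadj _ brE]]] := krein_formP K.
split=> [z c x y|x y].
  by rewrite !brE linearP linearDl linearZl_LR.
by rewrite !brE Jadj hermC expr0 mul1r.
Qed.
Local Notation hbr := krein_hermitian_form.

Lemma krein_form_le x y : `|br x y| <= `|x| * `|y|.
Proof.
have [ip [J [ipE Jadj JK brE]]] := krein_formP K.
have hip := hermitian_form_dot ip.
have ip0 u : 0 <= ip u u by rewrite -ipE exprn_ge0.
have re u : (Re (ip u u))%:C = `|u| ^+ 2.
  by rewrite ipE RRe_real// ger0_real.
rewrite -(@ler_pXn2r _ 2)// ?nnegrE ?mulr_ge0// exprMn -!re normc_sqr.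
by rewrite -rmorphM/= lecR brE -[ip x x](congr1 (ip x) (JK x)) -Jadj hf_CS.
Qed.

(** If [x] is orthogonal to [D], take [z] in [D] within distance [|x|] of [J x].
    Then [|x| ^ 2 = [x, J x - z]] is less than [|x| ^ 2] unless [x = 0]. *)
Lemma krein_separated D x : dense D -> (forall z, D z -> br x z = 0) -> x = 0.
Proof.
move=> dD x0; have [ip [J [ipE Jadj JK brE]]] := krein_formP K.
have nJ : `|J x| = `|x|.
  by apply: (@pexpIrn _ 2); rewrite ?nnegrE// !ipE Jadj JK.
apply/eqP; rewrite -normr_eq0; apply/negPn/negP => xn0.
have x_gt0 : 0 < `|x| by rewrite lt_def xn0 normr_ge0.
have [|z [Jz Dz]] := dD (ball (J x) `|x|) _ (ball_open _ _).
  by exists (J x); apply: ballxx.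
move: Jz; rewrite -ball_normE /ball_ /= => lt_z.
have := krein_form_le x (J x - z).
rewrite (hfDr hbr) (hfNr hbr) (x0 z Dz) subr0 brE -ipE nJ.
by rewrite normrX normr_id expr2 ler_pM2l// (lt_geF lt_z).
Qed.

(** On the graph of [T] one has [[b, z] = [a, S z]] for every [z] in [D]; by
    continuity this persists on the closure of the graph, where it determines
    the second coordinate. *)
Lemma krein_adjoint_closable D (T S : K -> K) : dense D ->
  (forall x y, D x -> D y -> br (T x) y = br x (S y)) -> closable D T.
Proof.
move=> dD TS.
have main x y z : closure (op_graph D T) (x, y) -> D z -> br y z = br x (S z).
  move=> cl Dz; apply/eqP; rewrite -subr_eq0 -normr_eq0; apply/negPn/negP => dn0.
  set d := `| _ | in dn0.
  have d0 : 0 < d by rewrite lt_def dn0 normr_ge0.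
  have M0 : 0 < `|z| + `|S z| + 1 by rewrite ltr_wpDl ?addr_ge0.
  have e0 : 0 < d / (`|z| + `|S z| + 1) by rewrite divr_gt0.
  have [[a b] [[/= Da ->] [/= xa yb]]] := cl _ (nbhsx_ballx (x, y) _ e0).
  move: xa yb; rewrite -!ball_normE /ball_ /= => xa yb.
  suff : d < d by rewrite ltxx.
  have dE : d = `|br (y - T a) z - br (x - a) (S z)|.
    by rewrite !(hfDl hbr) !(hfNl hbr) TS// opprB addrA subrK.
  rewrite {1}dE; apply: (le_lt_trans (ler_normB _ _)).
  apply: (@le_lt_trans _ _ (d / (`|z| + `|S z| + 1) * (`|z| + `|S z|))).
    rewrite mulrDr; apply: lerD; apply: (le_trans (krein_form_le _ _));
      by rewrite ler_wpM2r// ltW.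
  by rewrite mulrAC ltr_pdivrMr// ltr_pM2l// ltrDl.
move=> x y y' cy cy'; apply/eqP; rewrite -subr_eq0; apply/eqP.
apply: (krein_separated dD) => z Dz.
by rewrite (hfDl hbr) (hfNl hbr) (main x y)// (main x y')// subrr.
Qed.

End Krein.

(** * Linear and sesquilinear extension *)

Section Extension.
Variables (R : realType) (W : monomType).
Local Notation A := {malg R[i][W]}.
Implicit Types (P Q : A) (s : W -> R[i]) (B : W -> W -> R[i]).

Definition linext s P : R[i] := mmap idfun s P.

Fact linext_linear s : scalar (linext s).
Proof.
move=> c P Q; rewrite /linext raddfD/=; congr (_ + _).
rewrite (mmapEw (msuppZ_le c P)) mmapE mulr_sumr; apply: eq_bigr => w _.
by rewrite mcoeffZ /= mulrA.
Qed.
HB.instance Definition _ s := GRing.isLinear.Build R[i] A R[i] *%R (linext s) (linext_linear s).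

Lemma linextE s P : linext s P = \sum_(w <- msupp P) P@_w * s w.
Proof. exact: mmapE. Qed.

Lemma linextU s c w : linext s << c *g w >> = c * s w.
Proof. exact: mmapU. Qed.

(** The sesquilinear form on the monoid algebra whose value at the monomials
    [(w, v)] is [B v w]; in this order it is linear in its first argument. *)
Definition sesqext B P Q : R[i] :=
  \sum_(v <- msupp Q) (Q@_v)^* * linext (B v) P.

Lemma hermitian_sesqext B : hermitian_kernel B -> hermitian_form (sesqext B).
Proof.
move=> hB; split=> [Q c P1 P2|P Q].
  rewrite /sesqext mulr_sumr -big_split; apply: eq_bigr => v _.
  by rewrite linearP /= mulrDr mulrCA.
rewrite /sesqext rmorph_sum /=.
under eq_bigr do rewrite linextE mulr_sumr.
under [RHS]eq_bigr do rewrite linextE rmorphM rmorph_sum mulr_sumr /=.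
rewrite exchange_big; apply: eq_bigr => w _; apply: eq_bigr => v _ /=.
by rewrite conjCK rmorphM /= -hB mulrCA.
Qed.

Lemma kernel_form_sesqext B (f : {fsfun W -> R[i] with 0}) :
  kernel_form B f f = sesqext B (mkmalg f) (mkmalg f).
Proof.
rewrite /kernel_form /sesqext /msupp mkmalgK; apply: eq_bigr => v _.
rewrite linextE /msupp mkmalgK mulr_sumr; apply: eq_bigr => w _.
by rewrite mulrC (mulrC (B v w)).
Qed.

Lemma sesqext_kernel_form B P :
  sesqext B P P = kernel_form B (malg_val P) (malg_val P).
Proof. by rewrite kernel_form_sesqext; congr sesqext; apply/malgP => w. Qed.

Lemma kernel_form_gram (V : lmodType R[i]) (F : V -> V -> R[i]) (u : W -> V)
    (f : {fsfun W -> R[i] with 0}) : hermitian_form F ->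
  kernel_form (fun v w => F (u w) (u v)) f f =
  F (\sum_(w <- finsupp f) f w *: u w) (\sum_(w <- finsupp f) f w *: u w).
Proof.
move=> hF; rewrite (hf_sumr hF) /kernel_form; apply: eq_bigr => v _.
rewrite (hf_suml hF); apply: eq_bigr => w _.
by rewrite (hfZl hF) (hfZr hF); ring.
Qed.

End Extension.

(** * The involution *)

Section Star.
Variables (R : realType) (N : nat).
Local Notation A := (ncpoly R N).
Implicit Types (P Q : A) (v w : {fmonom 'I_N}).

Lemma word_revK : involutive (@word_rev N).
Proof. by move=> w; rewrite /word_rev /= revK fmK. Qed.

Lemma word_revM v w : word_rev (mmul v w) = mmul (word_rev w) (word_rev v).
Proof.
by apply/eqP; rewrite fmP /word_rev /= !fmM /= rev_cat.
Qed.

Lemma mcoeff_star P w : (ncpoly_star P)@_w = (P@_(word_rev w))^*.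
Proof.
rewrite /ncpoly_star raddf_sum {3}(monalgE P) raddf_sum rmorph_sum /=.
apply: eq_bigr => u _; rewrite !mcoeffU raddfMn /=; congr (_ *+ _).
by rewrite -(inj_eq (inv_inj word_revK)) word_revK.
Qed.

Fact star_additive : {morph @ncpoly_star R N : P Q / P + Q}.
Proof.
move=> P Q; apply/malgP => w.
rewrite mcoeff_star (mcoeffD (word_rev w) P Q).
rewrite (mcoeffD w (ncpoly_star P) (ncpoly_star Q)) !mcoeff_star.
exact: rmorphD.
Qed.

Lemma star0 : ncpoly_star (0 : A) = 0.
Proof. by apply: (addrI (ncpoly_star 0)); rewrite -star_additive !addr0. Qed.

Lemma star_sum I (r : seq I) (F : I -> A) :
  ncpoly_star (\sum_(i <- r) F i) = \sum_(i <- r) ncpoly_star (F i).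
Proof. exact: (big_morph _ star_additive star0). Qed.

Lemma starU c w : ncpoly_star << c *g w >> = << c^* *g word_rev w >> :> A.
Proof.
apply/malgP => v; rewrite mcoeff_star !mcoeffU raddfMn; congr (_ *+ _).
by rewrite -(inj_eq (inv_inj word_revK)) word_revK.
Qed.

Lemma starK : involutive (@ncpoly_star R N).
Proof. by move=> P; apply/malgP => w; rewrite !mcoeff_star word_revK conjCK. Qed.

Lemma star1 : ncpoly_star (1 : A) = 1.
Proof. by rewrite starU conjC1; congr << _ *g _ >>; apply/eqP; rewrite fmP /= fm1. Qed.

Lemma malgUM c d v w : << c *g v >> * << d *g w >> = << c * d *g mmul v w >> :> A.
Proof. by rewrite malgM_def fgmulUU. Qed.

Lemma starM P Q : ncpoly_star (P * Q) = ncpoly_star Q * ncpoly_star P.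
Proof.
rewrite (monalgE P) (monalgE Q) mulr_suml !star_sum mulr_sumr.
apply: eq_bigr => v _; rewrite mulr_sumr star_sum mulr_suml.
apply: eq_bigr => w _.
by rewrite malgUM !starU malgUM word_revM rmorphM mulrC.
Qed.

Lemma starZ c P : ncpoly_star (c *: P) = c^* *: ncpoly_star P.
Proof. by apply/malgP => w; rewrite mcoeff_star 2!mcoeffZ mcoeff_star; apply: rmorphM. Qed.

(** Coefficients commute with the indeterminates; the involution reduces this to
    scaling of the left factor. *)
Lemma ncpoly_scaleAr c P Q : P * (c *: Q) = c *: (P * Q).
Proof.
apply: (can_inj starK).
transitivity (ncpoly_star (c *: Q) * ncpoly_star P); first exact: starM.
transitivity (c^* *: ncpoly_star (P * Q)); last exact/esym/starZ.
transitivity (c^* *: (ncpoly_star Q * ncpoly_star P)).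
  by rewrite starZ -scalerAl.
exact/congr1/esym/starM.
Qed.

(** The words in the product of [Y_v^*] and [Y_w] concatenate to
    [word_rev v] followed by [w], the argument of the moment in the Hankel
    kernel. *)
Lemma star_linext (s : {fmonom 'I_N} -> R[i]) P Q :
  linext s (ncpoly_star Q * P) = sesqext (hankel_kernel s) P Q.
Proof.
rewrite /sesqext {1}/ncpoly_star mulr_suml linear_sum; apply: eq_bigr => v _.
rewrite {1}(monalgE P) mulr_sumr linear_sum linextE mulr_sumr.
by apply: eq_bigr => w _; rewrite malgUM /= linextU mulrA.
Qed.

End Star.

(** * Moments of a GNS functional *)

(** [L] is the Gram kernel of the vectors [pi << w >> Om] for a positive inner
    product of the Krein space. *)
Lemma moments_majorant (R : realType) (N : nat) (s : {fmonom 'I_N} -> R[i])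
    (Z : {scalar ncpoly R N}) : gns_functional Z ->
  (forall w : {fmonom 'I_N}, s w = Z << w >>) ->
  exists L, [/\ positive_definite L,
     kernel_le (fun v w => - L v w) (hankel_kernel s)
   & kernel_le (hankel_kernel s) L].
Proof.
move=> [_ [K [D [pi [Om [rep DO ZE _]]]]]] sE.
have [ip [J [ipE Jadj JK brE]]] := krein_formP K.
pose u (w : {fmonom 'I_N}) : K := pi << w >> Om.
have hip := hermitian_form_dot ip.
have hNip : hermitian_form (fun x y => - ip x y).
  split=> [z c x y|x y]; first by rewrite (hf_linear hip) opprD mulrN.
  by rewrite (hf_sym hip) rmorphN.
have ip0 x : 0 <= ip x x by rewrite -ipE exprn_ge0.
have hbr := krein_hermitian_form K.
have KE : hankel_kernel s = fun v w => krein_form (u w) (u v).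
  apply/funext => v; apply/funext => w; rewrite /hankel_kernel sE.
  have -> : << mmul (word_rev v) w >> = << word_rev v >> * << w >> :> ncpoly R N.
    by rewrite malgUM mulr1.
  rewrite ZE (rep_mul rep)// (rep_adj rep _ DO); last exact: rep_dom_inv rep _ _ DO.
  by rewrite /= starU conjC1 word_revK.
have hL : hermitian_kernel (fun v w => ip (u w) (u v)) by move=> v w; apply: (hf_sym hip).
have hNL : hermitian_kernel (fun v w => - ip (u w) (u v)) by move=> v w; apply: (hf_sym hNip).
have hK : hermitian_kernel (hankel_kernel s) by rewrite KE => v w; apply: (hf_sym hbr).
have sqD x : ip (x + J x) (x + J x) = 2 * (ip x x + ip (J x) x).
  by rewrite !(hfDl hip) !(hfDr hip) -(Jadj x x) (Jadj x (J x)) JK; ring.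
have sqB x : ip (x - J x) (x - J x) = 2 * (ip x x - ip (J x) x).
  rewrite !(hfDl hip) !(hfDr hip) !(hfNl hip) !(hfNr hip).
  by rewrite -(Jadj x x) (Jadj x (J x)) JK; ring.
exists (fun v w => ip (u w) (u v)); split.
- by split => // f; rewrite (kernel_form_gram _ _ hip).
- split=> // f; rewrite KE (kernel_form_gram u f hbr) (kernel_form_gram u f hNip) brE.
  by rewrite -subr_ge0 opprK addrC -(@pmulr_rge0 _ 2)// -sqD.
- split=> // f; rewrite KE (kernel_form_gram u f hbr) (kernel_form_gram u f hip) brE.
  by rewrite -subr_ge0 -(@pmulr_rge0 _ 2)// -sqB.
Qed.

(** * The GNS construction *)

Lemma normr_Re_le (R : realType) (a b : R[i]) : - b <= a -> a <= b ->
  `|Re a| <= Re b.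
Proof.
case: a b => a a' [b b']; rewrite !lecE /= => /andP[_ h1] /andP[_ h2].
by rewrite ler_norml h1.
Qed.

Section GNS.
Variables (R : realType) (N : nat) (s : {fmonom 'I_N} -> R[i]).
Variable L : {fmonom 'I_N} -> {fmonom 'I_N} -> R[i].
Hypotheses (L_pd : positive_definite L)
  (leNL : kernel_le (fun v w => - L v w) (hankel_kernel s))
  (leL : kernel_le (hankel_kernel s) L).
Local Notation A := (ncpoly R N).
Implicit Types P Q : A.

Definition moment_functional : {scalar A} := linext s.
Local Notation Z := moment_functional.

Definition moment_form P Q : R[i] := Z (ncpoly_star Q * P).

Lemma moment_formE P Q : moment_form P Q = sesqext (hankel_kernel s) P Q.
Proof. exact: star_linext. Qed.

Lemma moment_form_hermitian : hermitian_form moment_form.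
Proof.
have -> : moment_form = sesqext (hankel_kernel s).
  by apply/funext => P; apply/funext => Q; apply: moment_formE.
by apply: hermitian_sesqext; case: leL.
Qed.

Lemma moment_formM P F G : moment_form (P * F) G = moment_form F (ncpoly_star P * G).
Proof. by rewrite /moment_form starM starK mulrA. Qed.

Lemma moment_form_majorant :
  majorant (fun P Q => Re (moment_form P Q)) (fun P => Re (sesqext L P P)).
Proof.
have [hL L0] := L_pd; split.
  apply: hf_hilbert_quad; first exact: hermitian_sesqext.
  by move=> P; rewrite sesqext_kernel_form.
move=> P; rewrite moment_formE !sesqext_kernel_form.
have [_ _ leN] := leNL; have [_ _ le] := leL.
apply: normr_Re_le; last exact: le.
apply: le_trans (leN (malg_val P)); rewrite le_eqVlt; apply/orP; left; apply/eqP.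
rewrite /kernel_form -sumrN; apply: eq_bigr => v _.
by rewrite -sumrN; apply: eq_bigr => w _; rewrite !mulNr.
Qed.

(** Left multiplication on the dense copy [range v] of the algebra.  If
    [v F = v G] then [v (P * F)] and [v (P * G)] pair equally with every
    [v H], by [moment_formM], and are equal by density; so the choice of a
    representative in [pi] is immaterial. *)
Lemma moment_functional_gns : gns_functional Z.
Proof.
have hB := moment_form_hermitian.
have Z1 P : Z P = moment_form P 1 by rewrite /moment_form star1 mul1r.
split.
  by move=> P; rewrite Z1 (hf_sym hB) /moment_form starK mulr1.
have [K [v [dv vE]]] :=
  krein_space_of_majorant (hf_hermitian_real_part hB) moment_form_majorant.
have {}vE F G : krein_form (v F) (v G) = moment_form F G.
  rewrite vE (hfZr hB) [RHS]complexE; case: (moment_form F G) => a b.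
  by apply/eqP; rewrite eq_complex /=; apply/andP; split; apply/eqP; ring.
pose pi P x := v (P * xget 0 [set F | v F = x]).
have piE P F : pi P (v F) = v (P * F).
  have vget : v (xget 0 [set G | v G = v F]) = v F.
    by apply: (@xgetPex _ 0 [set G | v G = v F]); exists F.
  apply/eqP; rewrite -subr_eq0 -linearB -mulrBr; apply/eqP.
  apply: (krein_separated dv) => _ [G _ <-].
  by rewrite vE moment_formM -vE linearB /= vget subrr (hf0l (krein_hermitian_form K)).
have adj P x y : range v x -> range v y ->
    krein_form (pi P x) y = krein_form x (pi (ncpoly_star P) y).
  by move=> [F _ <-] [G _ <-]; rewrite !piE !vE moment_formM.
have subv : is_subspace (range v).
  split; first by exists 0; rewrite ?linear0.
  by move=> a _ _ [F _ <-] [G _ <-]; exists (a *: F + G); rewrite ?linearP.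
exists K, (range v), pi, (v 1); split.
- split; [exact: subv|exact: dv|..].
  + by move=> P _ [F _ <-]; rewrite piE; exists (P * F).
  + move=> P a _ _ [F _ <-] [G _ <-].
    by rewrite -linearP !piE mulrDr ncpoly_scaleAr linearP.
  + by move=> P; apply: (krein_adjoint_closable dv); apply: adj.
  + by move=> a P Q _ [F _ <-]; rewrite !piE mulrDl -scalerAl linearP.
  + by move=> _ [F _ <-]; rewrite piE mul1r.
  + by move=> P Q _ [F _ <-]; rewrite !piE mulrA.
  + by move=> P y Dy x Dx; apply: adj.
- by exists 1.
- by move=> P; rewrite piE mulr1 vE -Z1.
- have -> : range (fun P => pi P (v 1)) = range v.
    by apply/seteqP; split=> _ [P _ <-]; exists P; rewrite ?piE ?mulr1.
  exact: smallest_id.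
Qed.

End GNS.

Theorem theorem3p1 (R : realType) (N : nat) (hN : (0 < N)%N)
    (s : {fmonom 'I_N} -> R[i]) :
  (exists Z : {scalar ncpoly R N},
      gns_functional Z /\ forall w : {fmonom 'I_N}, s w = Z << w >>)
  <->
  (exists L : {fmonom 'I_N} -> {fmonom 'I_N} -> R[i],
      [/\ positive_definite L,
          kernel_le (fun v w => - L v w) (hankel_kernel s)
        & kernel_le (hankel_kernel s) L]).
Proof.
split=> [[Z [gZ sE]]|[L [L_pd leNL leL]]]; first exact: moments_majorant gZ sE.
exists (moment_functional s); split; first exact: moment_functional_gns leNL leL.
by move=> w; rewrite /= linextU mul1r.
Qed.
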